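(* Let $A$ and $C$ be locally compact abelian groups with $A$ divisible. Then every extension $0\to A\stackrel{\phi}{\to}B\stackrel{\psi}{\to}C\to 0$ of $A$ by $C$ in $\ell$ is a $TFU$ extension.
   Context: All groups are Hausdorff topological abelian groups, written additively. $\ell$ is the category of locally compact abelian (LCA) groups with continuous homomorphisms as morphisms. A morphism is proper if it is open onto its image. An extension of $A$ by $C$ in $\ell$ is a short exact sequence $0\to A\stackrel{\phi}{\to}B\stackrel{\psi}{\to}C\to 0$ in $\ell$ in which $\phi$ and $\psi$ are proper morphisms. For a group $G$, $G^{(1)}=\bigcap_{n\ge 1}nG$ is the first Ulm subgroup, and $\overline{S}$ denotes the closure of $S$. $G$ is divisible if $nG=G$ for every positive integer $n$. An extension $0\to A\stackrel{\phi}{\to}B\stackrel{\psi}{\to}C\to 0$ in $\ell$ is a $TFU$ extension if $0\to\overline{A^{(1)}}\stackrel{\overline{\phi}}{\to}\overline{B^{(1)}}\stackrel{\overline{\psi}}{\to}\overline{C^{(1)}}\to 0$ is an extension, where $\overline{\phi}=\phi|_{\overline{A^{(1)}}}$ and $\overline{\psi}=\psi|_{\overline{B^{(1)}}}$. *)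

(* Defs.v *)
From HB Require Import structures.
From mathcomp Require Import all_boot all_algebra all_classical.
From mathcomp Require Import topology normedtype.

Set Implicit Arguments.
Unset Strict Implicit.
Unset Printing Implicit Defensive.

Import GRing.Theory.
Local Open Scope classical_set_scope.
Local Open Scope ring_scope.

Definition is_lca (G : topologicalZmodType) : Prop :=
  hausdorff_space G /\ locally_compact [set: G].

#[short(type="continuousAdditiveType")]
HB.structure Definition ContinuousAdditive (G H : topologicalZmodType) :=
  {f of GRing.isNmodMorphism G H f & @isContinuous G H f}.

Notation "{ 'continuous_additive' G -> H }" :=
  (continuousAdditiveType G%type H%type)
  (at level 0, G at level 98, H at level 99) : type_scope.

(* [open onto its image]: the image carries the topology induced by [H]. *)
Definition proper_morphism (G H : topologicalZmodType)
    (f : {continuous_additive G -> H}) : Prop :=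
  forall U : set G, open U -> open (f @` U : set (subspace (range f))).

(* All three groups are required to be LCA, so that an extension is one in the
   category of LCA groups. *)
Record is_extension (A B C : topologicalZmodType)
    (phi : {continuous_additive A -> B}) (psi : {continuous_additive B -> C}) :
    Prop := IsExtension {
  extension_lca_l : is_lca A ;
  extension_lca_m : is_lca B ;
  extension_lca_r : is_lca C ;
  extension_injective : injective phi ;
  extension_exact : range phi = psi @^-1` [set 0] ;
  extension_surjective : range psi = [set: C] ;
  extension_proper_l : proper_morphism phi ;
  extension_proper_r : proper_morphism psi }.

Definition multiples (G : zmodType) (n : nat) : set G :=
  range (fun x : G => x *+ n).
Arguments multiples : clear implicits.

Definition divisible (G : zmodType) : Prop :=
  forall n : nat, (1 <= n)%N -> multiples G n = [set: G].

Definition first_ulm (G : zmodType) : set G :=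
  \bigcap_(n in [set n : nat | (1 <= n)%N]) multiples G n.
Arguments first_ulm : clear implicits.

(* [set_type] carries the topology induced by [G]; the group structure below is
   the one inherited from [G]. *)
Definition ulm_closure (G : topologicalZmodType) : Type :=
  set_type (closure (first_ulm G)).

Section UlmClosureGroup.
Variable G : topologicalZmodType.
Local Notation T := (ulm_closure G).

Lemma first_ulm0 : first_ulm G 0.
Proof. by move=> n _; exists 0; rewrite ?mul0rn. Qed.

Lemma first_ulmB (x y : G) :
  first_ulm G x -> first_ulm G y -> first_ulm G (x - y).
Proof.
move=> ux uy n n0; have [a _ <-] := ux n n0; have [b _ <-] := uy n n0.
by exists (a - b); rewrite // mulrnBl.
Qed.

Lemma closure_first_ulm_zmod_closed :
  zmod_closed [in closure (first_ulm G)].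
Proof.
split; first by rewrite inE; apply: subset_closure; exact: first_ulm0.
move=> x y; rewrite !inE => cx cy U.
move=> /(@sub_continuous G (x, y)) [[V W] /= [xV yW] VWU].
have [a [ua Va]] := cx _ xV; have [b [ub Wb]] := cy _ yW.
exists (a - b); split; first exact: first_ulmB.
exact: (VWU (a, b)).
Qed.

HB.instance Definition _ := SubType.copy T (set_type (closure (first_ulm G))).
HB.instance Definition _ :=
  Topological.copy T (set_type (closure (first_ulm G))).
HB.instance Definition _ := GRing.SubChoice_isSubZmodule.Build
  G [in closure (first_ulm G)] T closure_first_ulm_zmod_closed.

Lemma ulm_closure_val_continuous : continuous (val : T -> G).
Proof. exact: initial_continuous. Qed.

Lemma continuous_to_ulm_closure (X : topologicalType) (f : X -> T) :
  continuous (val \o f) -> continuous f.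
Proof. exact: continuous_comp_initial. Qed.

Lemma ulm_closure_sub_continuous : continuous (fun x : T * T => x.1 - x.2).
Proof.
apply: continuous_to_ulm_closure => x.
apply: (@continuous_comp _ _ _ (fun x : T * T => (val x.1, val x.2))
  (fun x : G * G => x.1 - x.2)); last exact: sub_continuous.
apply: cvg_pair.
- by apply: continuous_comp; [exact: cvg_fst|exact: ulm_closure_val_continuous].
- by apply: continuous_comp; [exact: cvg_snd|exact: ulm_closure_val_continuous].
Qed.

HB.instance Definition _ :=
  PreTopologicalNmodule_isTopologicalZmodule.Build T ulm_closure_sub_continuous.

End UlmClosureGroup.

Section UlmRestriction.
Variables (G H : topologicalZmodType) (f : {continuous_additive G -> H}).

Lemma first_ulm_image (x : G) : first_ulm G x -> first_ulm H (f x).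
Proof.
by move=> ux n n1; have [a _ <-] := ux n n1; exists (f a); rewrite ?raddfMn.
Qed.

Lemma ulm_closure_image (x : ulm_closure G) :
  f (val x) \in closure (first_ulm H).
Proof.
have := valP x; rewrite !inE => cx U /(cts_fun (s := f)) /cx[y [uy Uy]].
by exists (f y); split; [exact: first_ulm_image|].
Qed.

Definition ulm_restriction (x : ulm_closure G) : ulm_closure H :=
  Sub (f (val x)) (ulm_closure_image x).

Lemma ulm_restriction_nmod_morphism : nmod_morphism ulm_restriction.
Proof.
by split=> [|x y]; apply: val_inj; rewrite !SubK ?raddf0 ?raddfD.
Qed.

Lemma ulm_restriction_continuous : continuous ulm_restriction.
Proof.
apply: continuous_to_ulm_closure => x.
apply: (@continuous_comp _ _ _ (val : ulm_closure G -> G) f).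
  exact: ulm_closure_val_continuous.
exact: cts_fun.
Qed.

HB.instance Definition _ := GRing.isNmodMorphism.Build
  (ulm_closure G) (ulm_closure H) ulm_restriction ulm_restriction_nmod_morphism.
HB.instance Definition _ := isContinuous.Build
  (ulm_closure G) (ulm_closure H) ulm_restriction ulm_restriction_continuous.

End UlmRestriction.

Definition is_TFU_extension (A B C : topologicalZmodType)
    (phi : {continuous_additive A -> B}) (psi : {continuous_additive B -> C}) :
    Prop :=
  is_extension (ulm_restriction phi) (ulm_restriction psi).

(* Main.v *)
(** For divisible [A] the first Ulm subgroup of [A] is [A] itself, and
    [B^(1) = psi^-1(C^(1))]: if [psi b = n c] with [c = psi b'], then
    [b - n b'] lies in [phi A], hence is [n]-divisible, and so is [b].  As [psi]
    is open, preimages under it commute with closures, so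
    [closure (B^(1)) = psi^-1(closure (C^(1)))], and the restricted sequence
    is the restriction of the given one to a closed saturated subgroup of [B]. *)

Require Import Defs.
From mathcomp Require Import all_boot all_algebra all_classical.
From mathcomp Require Import topology normedtype.

Set Implicit Arguments.
Unset Strict Implicit.
Unset Printing Implicit Defensive.

Import GRing.Theory.
Local Open Scope classical_set_scope.
Local Open Scope ring_scope.

Lemma hausdorff_set_type (T : topologicalType) (A : set T) :
  hausdorff_space T -> hausdorff_space (set_type A).
Proof.
move=> hT p q pq; apply: val_inj; apply: hT => U V Up Vq.
have [r [Ur Vr]] := pq _ _ (@initial_continuous (set_type A) T set_val p U Up)
  (@initial_continuous (set_type A) T set_val q V Vq).
by exists (set_val r).
Qed.

(** The image filter under [set_val] contains [A], so its cluster point in [K] lies in the closure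
    of [A], hence in [A]; it then serves as a cluster point in the subspace. *)
Lemma compact_preimage_set_val (T : topologicalType) (A K : set T) :
  closed A -> compact K -> compact (set_val @^-1` K : set (set_type A)).
Proof.
move=> cA cK F FF FK.
have [p [Kp Fp]] := cK (fmap (set_val : set_type A -> T) F) _ FK.
have Ap : A p.
  have FA : F (set_val @^-1` A) by apply: filterE => x; exact: set_valP.
  by apply: cA => V; exact: Fp.
exists (SigSub (mem_set Ap)); split=> // U V FU [_ [[W oW <-] /= Wp WV]].
(* Clustering at [p] is known only for the image filter, so [U] is traded for its image in [T]. *)
have FU' : F (set_val @^-1` (set_val @` U)).
  by apply: filterS FU; exact: preimage_image.
have [_ [[x Ux <-] Wx]] := Fp _ _ FU' (open_nbhs_nbhs (conj oW Wp)).
by exists x; split=> //; exact: WV.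
Qed.

Lemma locally_compact_set_type (T : topologicalType) (A : set T) :
  closed A -> locally_compact [set: T] -> locally_compact [set: set_type A].
Proof.
move=> cA lcT x _; have [K xK [cK clK]] := lcT (set_val x) I.
rewrite withinET in xK.
have val_cts := @initial_continuous (set_type A) T set_val.
exists (set_val @^-1` K); first by rewrite withinET; exact: val_cts.
split; first exact: compact_preimage_set_val.
by move/continuous_closedP: val_cts; exact.
Qed.

Lemma is_lca_ulm_closure (G : topologicalZmodType) :
  is_lca G -> is_lca (ulm_closure G).
Proof.
move=> [hG lcG]; split; first exact: hausdorff_set_type.
by apply: locally_compact_set_type; first exact: closed_closure.
Qed.

Lemma divisible_first_ulm (G : zmodType) :
  divisible G -> first_ulm G = [set: G].
Proof. by move=> dG; apply/seteqP; split=> // x _ n /dG ->. Qed.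

Lemma divisible_in_ulm_closure (G : topologicalZmodType) (x : G) :
  divisible G -> x \in closure (first_ulm G).
Proof. by move=> dG; rewrite divisible_first_ulm// closureT in_setT. Qed.

(** The image of an open neighbourhood of [x] is a neighbourhood of [f x], so it meets [S]. *)
Lemma open_preimage_closure (X Y : topologicalType) (f : X -> Y) (S : set Y) :
  (forall U, open U -> open (f @` U)) ->
  f @^-1` closure S `<=` closure (f @^-1` S).
Proof.
move=> f_open x Sfx U; rewrite nbhsE => -[V [oV Vx] VU].
have [z [Sz [y Vy fy]]] : S `&` f @` V !=set0.
  by apply/Sfx/open_nbhs_nbhs; split; [exact: f_open|exists x].
by exists y; split; [rewrite /preimage/= fy|exact: VU].
Qed.

Lemma proper_surjective_open (G H : topologicalZmodType)
    (f : {continuous_additive G -> H}) (U : set G) :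
  proper_morphism f -> range f = [set: H] -> open U -> open (f @` U).
Proof.
move=> pf fT /pf /open_subspaceP[V oV]; rewrite fT !setIT => <-.
exact: oV.
Qed.

(** Restricting to subgroups can destroy openness onto the image: a point of the smaller target may
    be hit only from outside the smaller source. The saturation hypothesis excludes this, so the
    image of the trace of an open set is the trace of its image. *)
Lemma proper_ulm_restriction (G H : topologicalZmodType)
    (f : {continuous_additive G -> H}) :
  f @^-1` closure (first_ulm H) `<=` closure (first_ulm G) ->
  proper_morphism f -> proper_morphism (ulm_restriction f).
Proof.
move=> f_sat pf _ [U oU <-].
have /open_subspaceP[V oV VU] := pf U oU.
apply/open_subspaceP; exists (val @^-1` V); first by exists V.
apply/seteqP; split=> y [].
  move=> Vy [x _ xy]; split; last by exists x.
  have : (V `&` range f) (val y) by split=> //; exists (val x); rewrite -?xy.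
  rewrite VU => -[[z Uz zy] _].
  have Gz : z \in closure (first_ulm G).
    by rewrite inE; apply: f_sat; rewrite /preimage/= zy; exact: set_valP.
  by exists (SigSub Gz) => //; apply: val_inj.
move=> [x Ux <-] _; split; last by exists x.
have : (f @` U `&` range f) (f (val x)) by split; exists (val x).
by rewrite -VU => -[].
Qed.

Section DivisibleKernel.
Variables (A B C : topologicalZmodType).
Variables (phi : {continuous_additive A -> B}).
Variables (psi : {continuous_additive B -> C}).
Hypotheses (divA : divisible A) (ext : is_extension phi psi).

Lemma preimage_first_ulm : psi @^-1` first_ulm C `<=` first_ulm B.
Proof.
move=> b ub n n1; have [c _ cb] := ub n n1.
have : range psi c by rewrite (extension_surjective ext).
case=> b' _ b'c.
have : range phi (b - b' *+ n).
  by rewrite (extension_exact ext) /preimage/= raddfB raddfMn /= b'c cb subrr.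
case=> a _ ab; have : multiples A n a by rewrite divA.
(* With [n a' = a], one gets [n (phi a' + b') = (b - n b') + n b' = b]. *)
case=> a' _ a'a; exists (phi a' + b') => //.
by rewrite mulrnDl -raddfMn a'a /= ab subrK.
Qed.

Lemma preimage_ulm_closure :
  psi @^-1` closure (first_ulm C) `<=` closure (first_ulm B).
Proof.
apply: (subset_trans _ (closureS preimage_first_ulm)).
apply: open_preimage_closure => U.
by apply: proper_surjective_open;
  [exact: extension_proper_r ext|exact: extension_surjective ext].
Qed.

Lemma divisible_is_TFU_extension : is_TFU_extension phi psi.
Proof.
case: (ext) => lA lB lC inj exactB surj pl pr; split.
- exact: is_lca_ulm_closure.
- exact: is_lca_ulm_closure.
- exact: is_lca_ulm_closure.
- by move=> x y /(congr1 val)/inj/val_inj.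
- apply/seteqP; split=> y.
    move=> [x _ <-]; apply: val_inj => /=.
    by have : (psi @^-1` [set 0]) (phi (val x)) by rewrite -exactB; exists (val x).
  move=> /(congr1 val)/= y0.
  have : range phi (val y) by rewrite exactB.
  move=> [x _ xy]; exists (SigSub (divisible_in_ulm_closure x divA)) => //.
  exact: val_inj.
- apply/seteqP; split=> // c _.
  have : range psi (val c) by rewrite surj.
  (* Any lift of [c] to [B] will do, since the closure in [B] is saturated under [psi]. *)
  move=> [b _ bc]; have Bb : b \in closure (first_ulm B).
    rewrite inE; apply: preimage_ulm_closure; rewrite /preimage/= bc.
    exact: set_valP.
  by exists (SigSub Bb) => //; apply: val_inj.
(* Saturation is trivial for [phi]: the closure in [A] is all of [A]. *)
- apply: proper_ulm_restriction pl => x _; rewrite -inE.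
  exact: divisible_in_ulm_closure.
- exact: proper_ulm_restriction preimage_ulm_closure pr.
Qed.

End DivisibleKernel.

Theorem corollary2p4 (A C : topologicalZmodType)
    (lcaA : is_lca A) (lcaC : is_lca C) (divA : divisible A)
    (B : topologicalZmodType)
    (phi : {continuous_additive A -> B}) (psi : {continuous_additive B -> C}) :
  is_extension phi psi -> is_TFU_extension phi psi.
Proof. exact: divisible_is_TFU_extension. Qed.
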